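(* Let $(\Omega,\mathcal F,P)$ be an atomless probability space, $r\ge2$, $1\le\ell\le r-1$, and $X,Y\in\mathcal L_{r-1}(\Omega,\mathcal F,P)$. Then the problem $$\inf_Z\ W_\ell(X,Z)\quad\text{s.t. }Z\in A_r(Y)$$ is equivalent to the problem $$\inf_Z\ W_\ell(X,Z)\quad\text{s.t. }Z\succeq_{(r)}Y,\ \ Z\succeq_{(1)}X$$ (with $Z\in\mathcal L_{r-1}(\Omega,\mathcal F,P)$), in the sense that the two problems have the same optimal value. Additionally, for $\ell=1$, the objective function of the second problem takes on the form $W_1(Z,X)=\mathbb E[Z]-\mathbb E[X]$ for every feasible $Z$.
   Context: $\mathcal L_{s}(\Omega,\mathcal F,P)$ is the space of real random variables with finite $s$-th absolute moment. $F_Z(\eta)=P(Z\le\eta)$ and $F_Z^{(-1)}(p)=\inf\{\eta:F_Z(\eta)\ge p\}$, $p\in(0,1)$. For $r\ge 1$ and $Z\in\mathcal L_{r-1}$, $F_Z^{(r)}(\eta)=\frac1{\Gamma(r)}\mathbb E[\max(0,\eta-Z)^{r-1}]$, with $F_Z^{(1)}=F_Z$. Stochastic dominance of order $r$: for $Z,Y\in\mathcal L_{r-1}$, $Z\succeq_{(r)}Y$ iff $F_Z^{(r)}(\eta)\le F_Y^{(r)}(\eta)$ for all $\eta\in\mathbb R$; for $r=1$ this is equivalent to $F_Z^{(-1)}(p)\ge F_Y^{(-1)}(p)$ for all $p\in(0,1)$. $A_r(Y)=\{Z\in\mathcal L_{r-1}(\Omega,\mathcal F,P):Z\succeq_{(r)}Y\}$.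 $W_\ell(X,Z)=\big(\int_0^1|F_Z^{(-1)}(p)-F_X^{(-1)}(p)|^\ell dp\big)^{1/\ell}$. *)

(* Defs.v *)
From HB Require Import structures.
From mathcomp Require Import all_boot all_order all_algebra.
From mathcomp Require Import all_classical all_reals all_analysis.

Set Implicit Arguments.
Unset Strict Implicit.
Unset Printing Implicit Defensive.

Import Order.TTheory GRing.Theory Num.Theory.
Import numFieldNormedType.Exports.

Local Open Scope classical_set_scope.
Local Open Scope ring_scope.

Definition atomless d (T : measurableType d) (R : realType)
    (P : probability T R) : Prop :=
  forall A : set T, measurable A -> (0 < P A)%E ->
    exists B : set T, [/\ measurable B, B `<=` A, (0 < P B)%E & (P B < P A)%E].

Definition Gamma (R : realType) (r : R) : R :=
  \int[lebesgue_measure]_(t in `]0, +oo[) (t `^ (r - 1) * expR (- t)).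

Section stochastic_dominance.
Context d (T : measurableType d) (R : realType) (P : probability T R).

(* For s = 0, Lnorm is the constant 1 on a measurable function (as s^-1 = 0),
   so every random variable belongs to Lrv 0. *)
Definition Lrv (s : R) : set {RV P >-> R} :=
  [set Z | (Z : T -> R) \in Lfun P s%:E].

Definition quantile (Z : {RV P >-> R}) (p : R) : R :=
  inf [set eta : R | (p%:E <= cdf Z eta)%E].

(* The case r = 1 is separate because 0 `^ 0 = 1: the general formula would be
   the constant 1 instead of the distribution function. *)
Definition Fint (r : R) (Z : {RV P >-> R}) (eta : R) : \bar R :=
  if r == 1 then cdf Z eta
  else ((Gamma r)^-1%:E *
        'E_P[fun w => (Num.max 0 (eta - Z w) `^ (r - 1))%R])%E.

Definition dominates (r : R) (Z Y : {RV P >-> R}) : Prop :=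
  forall eta : R, (Fint r Z eta <= Fint r Y eta)%E.

Definition dominating_set (r : R) (Y : {RV P >-> R}) : set {RV P >-> R} :=
  [set Z | Lrv (r - 1) Z /\ dominates r Z Y].

Definition wasserstein (l : R) (X Z : {RV P >-> R}) : \bar R :=
  ((\int[lebesgue_measure]_(p in `]0%R, 1%R[)
      (`|quantile Z p - quantile X p| `^ l)%:E) `^ l^-1)%E.

End stochastic_dominance.

(* Main.v *)
(** Given [Z] feasible for the first problem, the competitor for the second one
    is the variable [Z'] whose quantile function is
    [max (quantile Z) (quantile X)].  It is first-order above [X], it is
    at least as good as [Z] for every order [r], and
    [|max (z, x) - x| <= |z - x|] shows that it is no further from [X].  It is
    realized as [max (quantile Z (U)) (quantile X (U))] for a uniform variable
    [U], which is where atomlessness is needed: a maximal chain of measurable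
    sets strictly ordered by [P] takes all the values of [[0, 1]], and [U] is
    read off its members as sublevel sets.  For [l = 1] and [Z] first-order
    above [X], the quantiles are ordered and the absolute value in the integral
    can be dropped. *)

Require Import Defs.
From HB Require Import structures.
From mathcomp Require Import all_boot all_order all_algebra.
From mathcomp Require Import all_classical all_reals all_analysis.
From mathcomp Require Import measurable_realfun.

Set Implicit Arguments.
Unset Strict Implicit.
Unset Printing Implicit Defensive.

Import Order.TTheory GRing.Theory Num.Theory.
Import numFieldNormedType.Exports.

Local Open Scope classical_set_scope.
Local Open Scope ring_scope.

(** * Maximal chains of measurable sets and the values of [P] on them *)

Section saturated_chains.
Context d (T : measurableType d) (R : realType) (P : probability T R).
Local Open Scope ereal_scope.

(* Members of equal measure are equal, not only equal almost surely. *)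
Definition measure_chain (C : set (set T)) : Prop :=
  C `<=` measurable /\
  forall A B, C A -> C B -> P A <= P B -> A `<=` B.

(* Maximality of the chain [C], in the form in which it is used: a set that can
   be inserted already belongs to [C]. *)
Definition saturated_chain (C : set (set T)) : Prop :=
  measure_chain C /\
  forall E, measurable E ->
    (forall A, C A -> (P A <= P E -> A `<=` E) /\ (P E <= P A -> E `<=` A)) ->
  C E.

(** Zorn's lemma: two members of a union of nested chains already lie in one of them, so the union
    is a chain. An insertable [E] outside a maximal [C] would make [C] with [E] added a strictly
    larger chain. *)
Lemma exists_saturated_chain : exists C, saturated_chain C.
Proof.
have [F FP Ftot|C [chC maxC]] := @Zorn_bigcup _ measure_chain.
  split=> [A [C FC CA]|A B [C FC CA] [C' FC' CB] AB].
    exact: (proj1 (FP _ FC)).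
  have [CC'|C'C] := Ftot _ _ FC FC'.
    by apply: (proj2 (FP _ FC')) => //; exact: CC'.
  by apply: (proj2 (FP _ FC)) => //; exact: C'C.
exists C; split=> // E mE insE; apply: contrapT => nCE.
apply: (maxC (C `|` [set E])).
  by split=> [|sub]; [exact: subsetUl|apply: nCE; apply: sub; right].
case: chC => mC monC; split=> [A [/mC//|->//]|A B [CA|->] [CB|->]//].
- exact: monC.
- exact: (proj1 (insE _ CA)).
- exact: (proj2 (insE _ CB)).
- by move=> _; exact: subset_refl.
Qed.

(** Complementation reverses both inclusion and the order of measures, so it preserves chains and
    insertability. This duality turns statements about floors into statements about ceilings. *)
Lemma saturated_chainC (C : set (set T)) :
  saturated_chain C -> saturated_chain [set A | C (~` A)].
Proof.
have PC A B : measurable A -> measurable B ->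
    (P (~` A) <= P B) = (P (~` B) <= P A).
  move=> mA mB; rewrite !probability_setC//.
  by rewrite leeBlDr ?fin_num_measure// leeBlDl ?fin_num_measure// addeC.
have PC' A B : measurable A -> measurable B ->
    (P A <= P (~` B)) = (P B <= P (~` A)).
  by move=> mA mB; rewrite -{1}[A]setCK PC ?setCK//; exact: measurableC.
have PCC A B : measurable A -> measurable B ->
    (P (~` A) <= P (~` B)) = (P B <= P A).
  by move=> mA mB; rewrite PC ?setCK//; exact: measurableC.
move=> [[mC monC] satC]; split; first split.
- by move=> A /= /mC /measurableC; rewrite setCK.
- move=> A B /= CA CB AB; rewrite -[A]setCK -[B]setCK; apply: subsetC.
  apply: monC => //; rewrite PCC//.
    by move/mC: CB => /measurableC; rewrite setCK.
  by move/mC: CA => /measurableC; rewrite setCK.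
- move=> E mE insE /=; apply: satC; first exact: measurableC.
  move=> A CA; have mA := mC _ CA.
  have [] := insE (~` A); first by rewrite /= setCK.
  move=> AE EA; split=> [|EA'].
    by rewrite PC' // => /EA /subsetC; rewrite setCK.
  by apply: subsetCl; apply: AE; rewrite PC.
Qed.

(** If the measures of the members below [s] had no maximum, the union of a countable cofinal family
    of these members would still have measure at most [s] and could be inserted. It would then be a
    largest such member, a contradiction. *)
Lemma saturated_chain_floor (C : set (set T)) (s : \bar R) :
  saturated_chain C -> 0 <= s ->
  exists A, [/\ C A, P A <= s &
                forall B, C B -> P B <= s -> P B <= P A].
Proof.
move=> [[mC monC] satC] s0.
have [C0 CC0 C0s] : exists2 C0, C C0 & P C0 <= s.
  apply: contrapT => noC.
  (* If every member had measure above [s], the empty set could be inserted, although its measure 0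
     is at most [s]. *)
  have C0 : C set0.
    apply: satC => // A CA; split=> [|_]; last exact: sub0set.
    rewrite measure0 => A0; exfalso; apply: noC; exists A => //.
    exact: le_trans A0 _.
  by apply: noC; exists set0; rewrite ?measure0.
apply: contrapT => noA.
have larger A : C A -> P A <= s -> exists B, [/\ C B, P B <= s & P A < P B].
  move=> CA As; apply: contrapT => nB; apply: noA; exists A; split=> // B CB Bs.
  by rewrite leNgt; apply/negP => AB; apply: nB; exists B.
(* As the measures of the members below [s] have no maximum, every such member
   is separated by a rational [q] from a larger one, hence included in [F q]. *)
have /choice[F FP] (q : rat) : exists A, [/\ C A, P A <= s &
    forall B, C B -> P B <= s -> (ratr q)%:E < P B -> (ratr q)%:E < P A].
  have [[A [CA As qA]]|nA] := pselect
    (exists A, [/\ C A, P A <= s & (ratr q)%:E < P A]); first by exists A.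
  by exists C0; split=> // B CB Bs qB; exfalso; apply: nA; exists B.
pose G n := F (odflt 0%R (unpickle n)).
have CG n : C (G n) by case: (FP (odflt 0%R (unpickle n))).
have Gs n : P (G n) <= s by case: (FP (odflt 0%R (unpickle n))).
have cofinalG A : C A -> P A <= s -> exists n, A `<=` G n.
  move=> CA As; have [B [CB Bs AB]] := larger _ CA As.
  have : (fine (P A) < fine (P B))%R.
    by rewrite -lte_fin !fineK ?fin_num_measure//; exact: mC.
  move=> /rat_in_itvoo[q]; rewrite in_itv/= -!lte_fin.
  rewrite !fineK ?fin_num_measure//; [|exact: mC..] => /andP[Aq qB].
  exists (pickle q); rewrite /G pickleK/=; apply: monC => //.
    by case: (FP q).
  by apply/ltW/(lt_trans Aq); case: (FP q) => _ _; apply; [exact: CB|..].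
(* [G] need not be monotone, while continuity from below requires it. A finite union of members of a
   chain is one of these members, so [D n] stays in [C] and below [s]. *)
pose D n := \big[setU/set0]_(i < n.+1) G i.
have CD n : C (D n) /\ P (D n) <= s.
  elim: n => [|n [CDn Dns]]; first by rewrite /D big_ord1.
  rewrite /D big_ord_recr -/(D n)/=.
  have [DG|GD] := leP (P (D n)) (P (G n.+1)).
    by rewrite (setUidPr _ _).2//; exact: monC.
  by rewrite (setUidPl _ _).2//; apply: monC => //; exact: ltW.
pose E := \bigcup_n G n.
have mE : measurable E by apply: bigcupT_measurable => n; exact: mC.
have Es : P E <= s.
  rewrite /E -bigcup_bigsetU_bigcup.
  have : P \o D @ \oo --> P (\bigcup_n D n).
    apply: nondecreasing_cvg_mu.
    - by move=> n; apply: mC; case: (CD n).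
    - by rewrite bigcup_bigsetU_bigcup.
    - by move=> n m nm; apply/subsetPset; exact: subset_bigsetU.
  move=> PD; rewrite -(cvg_lim _ PD)//; apply: lime_le.
    by apply/cvg_ex; eexists; exact: PD.
  by apply: nearW => n; case: (CD n).
have subE A : C A -> P A <= s -> A `<=` E.
  by move=> CA As; have [n An] := cofinalG _ CA As;
  apply: (subset_trans An); exact: bigcup_sup.
have CE : C E.
  apply: satC => // A CA; split=> [AE|EA].
    by apply: subE => //; exact: le_trans AE _.
  apply: bigcup_sub => n _; apply: monC => //; apply: le_trans EA.
  by rewrite le_measure ?inE//; [exact: mC|exact: bigcup_sup].
have [B [CB Bs]] := larger _ CE Es; apply/negP; rewrite -leNgt.
by rewrite le_measure ?inE//; [exact: mC|exact: subE].
Qed.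

(** The floor at level [1 - s] of the chain of complements, complemented back. *)
Lemma saturated_chain_ceil (C : set (set T)) (s : \bar R) :
  saturated_chain C -> s <= 1 ->
  exists B, [/\ C B, s <= P B &
                forall A, C A -> s <= P A -> P B <= P A].
Proof.
move=> satC s1; have [[mC _] _] := satC.
have PC A : C A -> (P (~` A) <= 1 - s) = (s <= P A).
  move=> /mC mA; rewrite probability_setC//.
  by case: s s1 => [s| |]//= s1; rewrite -(fineK (fin_num_measure P _ mA))
    ?lee_fin ?lerD2l ?lerN2 ?leey ?leNye.
have [|A [/= CA As Amax]] :=
  saturated_chain_floor (s := 1 - s) (saturated_chainC satC).
  by rewrite sube_ge0 ?fin_num1 ?orbT.
exists (~` A); split=> //.
  by rewrite -PC// setCK.
move=> B CB sB; have := Amax (~` B); rewrite /= setCK PC// => /(_ CB sB).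
have mA : measurable A by move/mC: CA => /measurableC; rewrite setCK.
have mB := mC _ CB.
rewrite !probability_setC// leeBlDr ?fin_num_measure//.
by rewrite leeBlDr ?fin_num_measure// addeC.
Qed.

(** Let [A] and [B] be the floor and the ceiling of [s]. If both missed [s], atomlessness would give
    a part [E0] of the gap [B \ A] with measure strictly between 0 and that of the gap. Then [A]
    with [E0] added can be inserted, which contradicts the choice of [A] or of [B]. *)
Lemma saturated_chain_onto (C : set (set T)) (s : \bar R) :
  atomless P -> saturated_chain C -> 0 <= s <= 1 -> exists2 A, C A & P A = s.
Proof.
move=> aP satC /andP[s0 s1]; have [[mC monC] insC] := satC.
have [A [CA As Amax]] := saturated_chain_floor satC s0.
have [B [CB sB Bmin]] := saturated_chain_ceil satC s1.
have [->|sA] := eqVneq s (P A); first by exists A.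
have [->|sB'] := eqVneq s (P B); first by exists B.
have {}As : P A < s by rewrite lt_neqAle eq_sym sA.
have {sB'}sB : s < P B by rewrite lt_neqAle sB'.
have mA := mC _ CA; have mB := mC _ CB.
have AB : A `<=` B by apply: monC => //; exact/ltW/(lt_trans As).
have PBA : P (B `\` A) = P B - P A.
  by rewrite measureD ?(setIidPr _ _).2// -ge0_fin_numE// fin_num_measure.
have [||E0 [mE0 E0BA E0_gt0 E0_lt]] := aP (B `\` A); first exact: measurableD.
  by rewrite PBA sube_gt0; exact: lt_trans sB.
pose E := A `|` E0.
have mE : measurable E by exact: measurableU.
have PE : P E = P A + P E0.
  rewrite measureU//; apply/seteqP; split=> // t [At /E0BA[_]]; exact.
have AE : P A < P E by rewrite PE lteDl ?fin_num_measure.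
have EB : P E < P B.
  by rewrite PE -lteBrDl ?fin_num_measure// -PBA.
have EsubB : E `<=` B by move=> t [/AB//|/E0BA[]].
(* No member has measure strictly between those of [A] and [B]. Hence each [D] lies inside [A] or
   contains [B], and is comparable with [E]. *)
have CE : C E.
  apply: insC => // D CD; have mD := mC _ CD; split.
    move=> DE; have [Ds|sD] := leP (P D) s.
      by apply: (@subset_trans _ A); [apply: monC => //; exact: Amax|left].
    have := lt_le_trans (le_lt_trans DE EB) (Bmin _ CD (ltW sD)).
    by rewrite ltxx.
  move=> ED; have [Ds|sD] := leP (P D) s.
    have := lt_le_trans (lt_le_trans AE ED) (Amax _ CD Ds).
    by rewrite ltxx.
  apply: (@subset_trans _ B) => //; apply: monC => //.
  exact: Bmin (ltW sD).
have [Es|sE] := leP (P E) s.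
  by have := lt_le_trans AE (Amax _ CE Es); rewrite ltxx.
by have := le_lt_trans (Bmin _ CE (ltW sE)) EB; rewrite ltxx.
Qed.

End saturated_chains.

(** * Distribution functions, and a uniform variable on an atomless space *)

Lemma cdfE d (T : measurableType d) (R : realType) (P : probability T R)
    (X : {RV P >-> R}) (t : R) : cdf X t = P [set w | X w <= t].
Proof.
by rewrite /cdf /distribution /pushforward; congr (P _); apply/seteqP;
  split=> w /=; rewrite in_itv.
Qed.

Lemma measurable_sublevel d (T : measurableType d) (R : realType)
    (X : {mfun T >-> R}) (t : R) : measurable [set w | X w <= t].
Proof.
rewrite (_ : [set w | X w <= t] = X @^-1` `]-oo, t]).
  exact: measurable_funPTI.
by apply/seteqP; split=> w /=; rewrite in_itv.
Qed.

(** [U w] is the infimum of the levels [t] with [w] in [S t]. As [S] is not assumed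
    right-continuous, the sublevel set of [U] at [t] is only squeezed between [S t] and every [S s]
    with [t < s]. *)
Lemma random_variable_of_sublevels d (T : measurableType d) (R : realType)
    (S : R -> set T) (a b : R) :
  (forall t, measurable (S t)) -> (forall s t, s <= t -> S s `<=` S t) ->
  (forall t, t < a -> S t = set0) -> S b = setT ->
  exists U : {mfun T >-> R}, forall t w,
    (S t w -> U w <= t) /\ (forall s, U w <= t -> t < s -> S s w).
Proof.
move=> mS ndS S0 S1.
pose f (w : T) : R := inf [set t | S t w].
have fS t w : S t w -> f w <= t.
  move=> Stw; apply: ge_inf => //; exists a => s /= Ssw.
  by rewrite leNgt; apply/negP => /S0 S0s; rewrite S0s in Ssw.
have Sf s w : f w < s -> S s w.
  move=> fs; have [|t /= Stw ts] := inf_lt _ fs; last exact: (ndS t s (ltW ts)).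
  by exists b; rewrite /= S1.
have mf : measurable_fun setT f.
  apply: (measurability _ (RGenInftyO.measurableE R)) => _ [_ [x ->] <-].
  rewrite setTI (_ : _ @^-1` _ = \bigcup_(q : rat)
    (if ratr q < x then S (ratr q) else set0)); last first.
    apply/seteqP; split=> w /=.
      rewrite in_itv/= => /rat_in_itvoo[q]; rewrite in_itv/= => /andP[fq qx].
      by exists q => //; rewrite qx; exact: Sf.
    move=> [q _]; case: ifPn => // qx /fS; rewrite in_itv/= => fq.
    exact: le_lt_trans qx.
  by apply: bigcupT_measurable_rat => q; case: ifP.
pose U : {mfun T >-> R} := HB.pack f (isMeasurableFun.Build _ _ _ _ _ mf).
exists U => t w; split=> [|s Ut ts]; first exact: fS.
by apply: Sf; exact: le_lt_trans ts.
Qed.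

(** Chain members of measure [t] increase with [t] and serve as approximate sublevel sets of [U].
    The distribution function is then squeezed between [t] and every [s] in []t, 1]]. *)
Lemma atomless_uniform d (T : measurableType d) (R : realType)
    (P : probability T R) : atomless P ->
  exists U : {RV P >-> R}, forall t, 0 <= t <= 1 -> cdf U t = t%:E.
Proof.
move=> aP; have [C satC] := exists_saturated_chain P.
have /choice[S0 S0P] (t : R) : exists A, 0 <= t <= 1 -> C A /\ P A = t%:E.
  have [t01|] := boolP (0 <= t <= 1); last by exists set0.
  have [|A CA PA] := saturated_chain_onto (s := t%:E) aP satC.
    by rewrite !lee_fin.
  by exists A.
have [[mC monC] _] := satC.
(* The chain member of measure 1 may miss a null set, hence [setT] from 1 on. With [set0] below 0,
   the levels defining [U] form a nonempty set bounded below. *)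
pose S t := if t < 0 then set0 else if t < 1 then S0 t else setT.
have mS t : measurable (S t).
  rewrite /S; case: ltP => // t0; case: ltP => // t1.
  by apply: mC; apply: (S0P t _).1; rewrite t0 ltW.
have ndS s t : s <= t -> S s `<=` S t.
  rewrite /S => st; case: (ltP s 0) => [_|s0]; first exact: sub0set.
  rewrite (ltNge t 0) (le_trans s0 st)/=.
  case: (ltP t 1) => [t1|_]; last exact: subsetT.
  have s1 := le_lt_trans st t1; rewrite s1.
  have [|CS PS] := S0P s; first by rewrite s0 ltW.
  have [|CT PT] := S0P t; first by rewrite (le_trans s0 st) ltW.
  by apply: monC => //; rewrite PS PT lee_fin.
have PS t : 0 <= t <= 1 -> P (S t) = t%:E.
  rewrite /S => /[dup] t01 /andP[t0 t1]; rewrite (ltNge t 0) t0/=.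
  have [t1'|t1'] := ltP t 1; first by case: (S0P t t01).
  by rewrite probability_setT; congr EFin; apply/le_anti/andP.
have [U US] : exists U : {RV P >-> R}, forall t w,
    (S t w -> U w <= t) /\ (forall s, U w <= t -> t < s -> S s w).
  apply: (@random_variable_of_sublevels _ T R S 0 1) => //.
    by move=> t t0; rewrite /S t0.
  by rewrite /S ltxx ltNge ler01.
have PSU t : (P (S t) <= cdf U t)%E.
  rewrite cdfE; rewrite le_measure ?inE//.
    exact: measurable_sublevel.
  by move=> w /(US _ _).1.
have PUS s t : t < s -> (cdf U t <= P (S s))%E.
  move=> ts; rewrite cdfE; rewrite le_measure ?inE//.
    exact: measurable_sublevel.
  by move=> w Ut; exact: (US t w).2.
exists U => t /[dup] t01 /andP[t0 t1]; apply/le_anti/andP; split; last first.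
  by rewrite -PS.
have [t1'|] := ltP t 1; last first.
  move=> t1'; have -> : t = 1 by apply/le_anti/andP.
  exact: cdf_le1.
apply/lee_addgt0Pr => e e0; pose s := Num.min (t + e) 1.
have ts : t < s by rewrite lt_min ltrDl e0.
apply: (le_trans (PUS s t ts)); rewrite PS; last first.
  by rewrite (le_trans t0 (ltW ts)) ge_min lexx orbT.
by rewrite -EFinD lee_fin ge_min lexx.
Qed.

(** * Integrability and equality in law *)

Lemma Lfun_lty d (T : measurableType d) (R : realType) (P : probability T R)
    (X : {RV P >-> R}) (p : R) : 0 < p ->
  ((X : T -> R) \in Lfun P p%:E) = (\int[P]_w (`|X w| `^ p)%:E < +oo)%E.
Proof.
move=> p0; have I0 : (0 <= \int[P]_w (`|X w| `^ p)%:E)%E.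
  by apply: integral_ge0 => w _; rewrite lee_fin powR_ge0.
apply/idP/idP => [|Xp].
  rewrite inE => /andP[_]; rewrite inE/= /finite_norm => /(poweR_lty p).
  by rewrite poweR_Lnorm ?gt_eqF.
rewrite inE; apply/andP; split; rewrite inE//=.
by rewrite /finite_norm unlock /Lnorm poweR_lty.
Qed.

Section equality_in_law.
Context d1 d2 (T1 : measurableType d1) (T2 : measurableType d2) (R : realType)
  (P : probability T1 R) (Q : probability T2 R).
Local Open Scope ereal_scope.

(** Two probability spaces are allowed, so that a variable on [T] can be compared with its quantile
    function on the unit interval. *)
Definition eq_law (X : {RV P >-> R}) (Y : {RV Q >-> R}) : Prop :=
  forall A : set R, measurable A -> distribution P X A = distribution Q Y A.

(** The rays []x, +oo[] are stable under intersection, generate the Borel sets and exhaust the line.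
    Their probabilities are complements of values of the distribution function. *)
Lemma eq_cdf_eq_law (X : {RV P >-> R}) (Y : {RV Q >-> R}) :
  (forall t, cdf X t = cdf Y t) -> eq_law X Y.
Proof.
move=> XY A; apply: (@measure_unique _ R R (@RGenOInfty.G R)
  (fun n => `](- n%:R)%R, +oo[%classic) _ _ _ _
  (distribution P X) (distribution Q Y)).
- exact: RGenOInfty.measurableE.
- move=> _ _ [x ->] [y ->]; exists (Num.max x y); apply/seteqP.
  by split=> t /=; rewrite !in_itv/= !andbT gt_max => /andP.
- by move=> n; eexists.
- apply/seteqP; split=> // x _; exists (Num.bound `|x|%R) => //=.
  rewrite in_itv/= andbT ltrNl (le_lt_trans _ (archi_boundP _))//.
  by rewrite -normrN ler_norm.
- move=> _ [x ->]; rewrite -setCitvl.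
  rewrite [LHS](probability_setC (distribution P X) _)//.
  rewrite [RHS](probability_setC (distribution Q Y) _)//.
  by congr (1 - _); exact: XY.
- by move=> n; rewrite (le_lt_trans (probability_le1 _ _))// ltry.
Qed.

Lemma eq_law_ge0_integral (X : {RV P >-> R}) (Y : {RV Q >-> R})
    (f : R -> \bar R) : eq_law X Y ->
  measurable_fun setT f -> (forall x, 0 <= f x) ->
  \int[P]_w f (X w) = \int[Q]_w f (Y w).
Proof.
move=> XY mf f0.
rewrite -(ge0_integral_distribution X mf f0) -(ge0_integral_distribution Y mf f0).
by apply: eq_measure_integral => A mA _; exact: XY.
Qed.

Lemma eq_law_Lfun (X : {RV P >-> R}) (Y : {RV Q >-> R}) (p : R) :
  (0 < p)%R -> eq_law X Y ->
  (X : T1 -> R) \in Lfun P p%:E -> (Y : T2 -> R) \in Lfun Q p%:E.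
Proof.
move=> p0 XY; rewrite !Lfun_lty// => Xp.
rewrite -(@eq_law_ge0_integral X Y (fun x => (`|x| `^ p)%:E))//.
by apply/measurable_EFinP; apply: (measurableT_comp (measurable_powR _)).
Qed.

Lemma eq_law_expectation (X : {RV P >-> R}) (Y : {RV Q >-> R}) :
  eq_law X Y -> (X : T1 -> R) \in Lfun P 1 -> 'E_P[X] = 'E_Q[Y].
Proof.
move=> XY LX; have LY := eq_law_Lfun ltr01 XY LX.
rewrite unlock.
rewrite -(@integral_distribution _ _ _ _ _ _ X EFin)//; last exact/Lfun1_integrable.
rewrite -(@integral_distribution _ _ _ _ _ _ Y EFin)//; last exact/Lfun1_integrable.
by apply: eq_measure_integral => A mA _; exact: XY.
Qed.

End equality_in_law.

Lemma eq_law_sym d1 d2 (T1 : measurableType d1) (T2 : measurableType d2)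
    (R : realType) (P : probability T1 R) (Q : probability T2 R)
    (X : {RV P >-> R}) (Y : {RV Q >-> R}) : eq_law X Y -> eq_law Y X.
Proof. by move=> XY A mA; rewrite XY. Qed.

(** * The uniform law on the unit interval *)

Section uniform01.
Context (R : realType).
Local Open Scope ereal_scope.
Let unif : probability _ R := uniform_prob (@ltr01 R).

Lemma integral_uniform01 (f : R -> \bar R) :
  measurable_fun setT f -> (forall x, 0 <= f x) ->
  \int[unif]_x f x = \int[lebesgue_measure]_(x in `]0%R, 1%R[) f x.
Proof.
move=> mf f0; rewrite integral_uniform// subr0 invr1 mul1e.
rewrite integral_itv_bndo_bndc ?integral_itv_obnd_cbnd//.
  exact: measurable_funTS.
exact: measurable_funTS.
Qed.

Lemma uniform01E (A : set R) : measurable A ->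
  unif A = lebesgue_measure (A `&` `]0%R, 1%R[).
Proof.
move=> mA; rewrite -integral_indic// -integral_uniform01//.
  by rewrite integral_indic// setIT.
exact/measurable_EFinP.
Qed.

Lemma uniform01_le (c : R) : (0 <= c <= 1)%R ->
  unif [set p | p <= c]%R = c%:E.
Proof.
move=> /andP[c0 c1]; have lec : [set p | p <= c]%R = `]-oo, c]%classic.
  by apply/seteqP; split=> x /=; rewrite in_itv.
rewrite uniform01E lec//.
have -> : `]-oo, c] `&` `]0%R, 1%R[ =
    [set` if (c < 1)%R then `]0%R, c] else `]0%R, 1%R[] :> set R.
  apply/seteqP; split=> x /=.
    rewrite !in_itv/= => -[xc /andP[x0 x1]].
    by case: (ltP c 1%R) => _ /=; rewrite x0.
  case: (ltP c 1%R) => c1'; rewrite /= !in_itv/= => /andP[x0 xc]; split=> //.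
    by rewrite x0 (le_lt_trans xc).
  - by rewrite (le_trans (ltW xc)).
  - by rewrite x0.
case: (ltP c 1%R) => c1'; rewrite lebesgue_measure_itv/= lte_fin.
  case: ifPn; rewrite ?sube0// -leNgt => c0'.
  by congr EFin; apply/le_anti/andP.
by rewrite ltr01 sube0; congr EFin; apply/le_anti/andP.
Qed.

End uniform01.

(** Monotonicity and the values at 0 and 1 force the distribution function outside [[0, 1]], so the
    hypothesis determines the whole law. *)
Lemma cdf_uniform_clamp d (T : measurableType d) (R : realType)
    (P : probability T R) (U : {RV P >-> R}) :
  (forall t, 0 <= t <= 1 -> cdf U t = t%:E) ->
  forall t, cdf U t = (Num.max 0 (Num.min t 1))%:E.
Proof.
move=> Ut t; have [t0|t0] := leP t 0.
  rewrite (min_idPl _); last exact: le_trans ler01.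
  rewrite max_l//; apply/le_anti/andP; split=> //.
  by have := cdf_nondecreasing U t0; rewrite (Ut 0) ?lexx ?ler01.
have [t1|t1] := leP t 1; first by rewrite max_r ?ltW// Ut// (ltW t0).
rewrite max_r//; apply/le_anti/andP; split; first exact: (cdf_le1 U t).
by have := cdf_nondecreasing U (ltW t1); rewrite (Ut 1) ?lexx ?ler01.
Qed.

(** * Quantile functions and the inverse transform *)

Section quantile.
Context d (T : measurableType d) (R : realType) (P : probability T R).
Implicit Types (X Z : {RV P >-> R}) (p t : R).

(** The Galois connection between quantile and distribution function. The limits of [cdf Z] at both
    infinities make the set of levels nonempty and bounded below; right continuity makes its infimum
    attained. *)
Lemma quantile_le Z p t : 0 < p < 1 ->
  (quantile Z p <= t) = (p%:E <= cdf Z t)%E.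
Proof.
move=> /andP[p0 p1]; set E := [set eta | (p%:E <= cdf Z eta)%E].
have [M EM] : exists M, E M.
  have near_gt : \forall x \near +oo, (p%:E < cdf Z x)%E.
    exact: (@cvg_cdfy1 _ _ _ _ Z _ (@open_ereal_gt' R 1%E p%:E p1)).
  by have [x /ltW] := filter_ex near_gt; exists x.
have lbE : has_lbound E.
  have near_lt : \forall x \near -oo, (cdf Z x < p%:E)%E.
    exact: (@cvg_cdfNy0 _ _ _ _ Z _ (@open_ereal_lt' R 0%E p%:E p0)).
  have [m mp] := filter_ex near_lt; exists m => x /= Ex.
  rewrite leNgt; apply/negP => xm.
  have := lt_le_trans (le_lt_trans (cdf_nondecreasing Z (ltW xm)) mp) Ex.
  by rewrite ltxx.
apply/idP/idP => [Zt|]; last by move=> pt; exact: ge_inf.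
apply: (@cvge_ge _ _ _ _ (cdf Z) _ _ _ (@cdf_right_continuous _ _ _ _ Z t)).
near=> s.
have : quantile Z p < s by apply: (le_lt_trans Zt); near: s; exact: nbhs_right_gt.
move=> /inf_lt[|eta /= pe /ltW es]; first by exists M.
exact: le_trans pe (cdf_nondecreasing Z es).
Unshelve. all: by end_near. Qed.

(* Outside `]0, 1[ the infimum defining the quantile may range over an empty or
   an unbounded set, where it is a junk value. *)
Definition quantile01 Z (p : R) : R :=
  if 0 < p < 1 then quantile Z p else 0.

Lemma measurable_quantile01 Z : measurable_fun setT (quantile01 Z).
Proof.
apply: (measurability _ (RGenOInfty.measurableE R)) => _ [_ [x ->] <-].
(* Inside []0, 1[] the Galois connection turns [x < quantile01 Z p] into [cdf Z x < p]; outside, the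
   value 0 exceeds [x] exactly when [x < 0]. *)
rewrite setTI (_ : _ @^-1` _ =
    (`]0, 1[ `&` `]fine (cdf Z x), +oo[) `|`
    (if x < 0 then ~` `]0, 1[ else set0)).
  apply: measurableU; first exact: measurableI.
  by case: ifP => // _; exact: measurableC.
have qx p : 0 < p < 1 -> (x < quantile01 Z p) = (fine (cdf Z x) < p).
  move=> p01; rewrite /quantile01 p01 !ltNge quantile_le//.
  by rewrite -lee_fin fineK// fin_num_measure.
apply/seteqP; split=> p /=; rewrite !in_itv/= !andbT.
- have [p01|p01] := boolP (0 < p < 1); first by rewrite qx//; left.
  rewrite /quantile01 (negbTE p01) => x0; right; rewrite x0 /= in_itv/=.
  exact/negP.
- move=> [[p01]|]; first by rewrite qx.
  case: ifP => // x0 /=; rewrite in_itv/= => /negP/negbTE p01.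
  by rewrite /quantile01 p01.
Qed.

HB.instance Definition _ Z :=
  isMeasurableFun.Build _ _ _ _ (quantile01 Z) (measurable_quantile01 Z).

Definition quantile_rv Z : {RV uniform_prob (@ltr01 R) >-> R} :=
  HB.pack (quantile01 Z : measurableTypeR R -> R)
    (isMeasurableFun.Build _ _ (measurableTypeR R) R (quantile01 Z)
      (measurable_quantile01 Z)).

Lemma quantile01_le Z p t : 0 < p < 1 ->
  (quantile01 Z p <= t) = (p <= fine (cdf Z t)).
Proof.
move=> p01; rewrite /quantile01 p01 quantile_le//.
by rewrite -lee_fin fineK// fin_num_measure.
Qed.

Lemma fine_cdf01 Z t : 0 <= fine (cdf Z t) <= 1.
Proof.
by rewrite fine_ge0//= -lee_fin fineK ?fin_num_measure// cdf_le1.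
Qed.

(** Inverse transform: on []0, 1[] the sublevel set at [t] is the set of [p] below [cdf Z t], whose
    uniform measure is [cdf Z t]. *)
Lemma quantile01_law Z :
  eq_law (quantile_rv Z) Z.
Proof.
apply: eq_cdf_eq_law => t; rewrite cdfE uniform01E; last first.
  exact: (measurable_sublevel (quantile01 Z)).
have -> : [set p | quantile01 Z p <= t] `&` `]0, 1[ =
    [set p | p <= fine (cdf Z t)] `&` `]0, 1[.
  by apply/seteqP; split=> p /= [+ p01]; move: (p01);
    rewrite in_itv/= => /quantile01_le ->.
rewrite -uniform01E.
  by rewrite uniform01_le ?fine_cdf01// fineK// fin_num_measure.
rewrite (_ : [set _ | _] = `]-oo, (fine (cdf Z t))]%classic)//.
Qed.

(** The uniform law is the law of the identity [I], and [U] and [I] have the same clamped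
    distribution function. *)
Lemma uniform_law (U : {RV P >-> R}) :
  (forall t, 0 <= t <= 1 -> cdf U t = t%:E) ->
  forall A, measurable A -> distribution P U A = uniform_prob (@ltr01 R) A.
Proof.
move=> Ut; pose I : {RV uniform_prob (@ltr01 R) >-> R} :=
  HB.pack (idfun : measurableTypeR R -> R)
    (isMeasurableFun.Build _ _ (measurableTypeR R) R idfun
      (@measurable_id _ _ setT)).
suff : eq_law U I by move=> UI A /UI.
apply: eq_cdf_eq_law => t; rewrite !cdf_uniform_clamp// => {}t t01.
by rewrite cdfE uniform01_le.
Qed.

Lemma quantile01_uniform_law (U : {RV P >-> R}) Z :
  (forall t, 0 <= t <= 1 -> cdf U t = t%:E) ->
  eq_law (quantile01 Z \o U : {RV P >-> R}) Z.
Proof.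
move=> /uniform_law UL A mA.
rewrite -(quantile01_law Z mA) /distribution.
rewrite /pushforward comp_preimage.
by apply: UL; rewrite -[X in measurable X]setTI; exact: measurable_quantile01.
Qed.

End quantile.

(** * The competitor built from the maximum of two quantile functions *)

Section quantile_coupling.
Context d (T : measurableType d) (R : realType) (P : probability T R).
Implicit Types (X Y Z : {RV P >-> R}) (l p t : R).

Definition quantile_max Z X (p : R) : R :=
  Num.max (quantile01 Z p) (quantile01 X p).

Lemma measurable_quantile_max Z X : measurable_fun setT (quantile_max Z X).
Proof. exact: measurable_maxr. Qed.

HB.instance Definition _ Z X :=
  isMeasurableFun.Build _ _ _ _ (quantile_max Z X) (measurable_quantile_max Z X).

Section uniform_variable.
Variable U : {RV P >-> R}.
Hypothesis Ut : forall t, 0 <= t <= 1 -> cdf U t = t%:E.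

(** A maximum is at most [t] when both quantiles are, that is when [p] is below both distribution
    functions at [t]. *)
Lemma cdf_quantile_max Z X t :
  cdf (quantile_max Z X \o U : {RV P >-> R}) t =
  Order.min (cdf Z t) (cdf X t).
Proof.
have cdfK (V : {RV P >-> R}) : cdf V t = (fine (cdf V t))%:E.
  by rewrite fineK// fin_num_measure.
rewrite cdfE (_ : P _ = distribution P U [set p | quantile_max Z X p <= t])//.
have mle : measurable [set p | quantile_max Z X p <= t].
  exact: (measurable_sublevel (quantile_max Z X)).
rewrite uniform_law// uniform01E//.
have -> : [set p | quantile_max Z X p <= t] `&` `]0, 1[ =
    [set p | p <= Num.min (fine (cdf Z t)) (fine (cdf X t))] `&` `]0, 1[.
  apply/seteqP; split=> p /= [+ p01]; move: (p01);
    by rewrite in_itv/= => p01'; rewrite /quantile_max ge_max le_min !quantile01_le.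
rewrite -uniform01E; last by rewrite (_ : [set _ | _] =
  `]-oo, (Num.min (fine (cdf Z t)) (fine (cdf X t)))]%classic).
rewrite uniform01_le; last first.
  have /andP[z0 z1] := fine_cdf01 Z t; have /andP[x0 x1] := fine_cdf01 X t.
  by rewrite le_min z0 x0 ge_min z1.
by rewrite EFin_min -!cdfK.
Qed.

(** By the Galois connection both sides have the same upper bounds. This makes the Wasserstein
    integrand of the competitor explicit. *)
Lemma quantile01_quantile_max Z X p :
  quantile01 (quantile_max Z X \o U : {RV P >-> R}) p = quantile_max Z X p.
Proof.
rewrite /quantile_max /quantile01; case: ifPn => [p01|_]; last by rewrite maxxx.
have le t : (quantile (quantile_max Z X \o U : {RV P >-> R}) p <= t) =
    (Num.max (quantile Z p) (quantile X p) <= t).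
  by rewrite ge_max !quantile_le// cdf_quantile_max le_min.
by apply/le_anti/andP; split; rewrite ?le// -le.
Qed.

(** The [s]-th absolute power of a maximum is at most the sum of the two powers, and composing the
    quantiles with [U] preserves the moments of [Z] and [X]. *)
Lemma quantile_max_Lrv (s : R) Z X : 0 < s -> Lrv s Z -> Lrv s X ->
  Lrv s (quantile_max Z X \o U : {RV P >-> R}).
Proof.
move=> s0; rewrite /Lrv/= => LZ LX.
have LZU : (quantile01 Z \o U : T -> R) \in Lfun P s%:E.
  exact: (eq_law_Lfun s0 (eq_law_sym (quantile01_uniform_law Z Ut)) LZ).
have LXU : (quantile01 X \o U : T -> R) \in Lfun P s%:E.
  exact: (eq_law_Lfun s0 (eq_law_sym (quantile01_uniform_law X Ut)) LX).
have mpow (V : {RV P >-> R}) :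
    measurable_fun setT (fun w => (`|V w| `^ s)%:E).
  apply/measurable_EFinP; apply: (measurableT_comp (measurable_powR _)).
  exact: measurableT_comp.
move: LZU LXU; rewrite (Lfun_lty (quantile01 Z \o U) s0).
rewrite (Lfun_lty (quantile01 X \o U) s0) (Lfun_lty (quantile_max Z X \o U) s0).
move=> Zlty Xlty.
apply: (@le_lt_trans _ _ (\int[P]_w ((`|quantile01 Z (U w)| `^ s)%:E +
    (`|quantile01 X (U w)| `^ s)%:E))%E).
  apply: ge0_le_integral => //.
  - apply: emeasurable_funD; first exact: (mpow (quantile01 Z \o U)).
    exact: (mpow (quantile01 X \o U)).
  - move=> w _; rewrite -EFinD lee_fin/= /quantile_max.
    case: (leP (quantile01 Z (U w)) (quantile01 X (U w))) => _.
      by rewrite lerDr powR_ge0.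
    by rewrite lerDl powR_ge0.
rewrite ge0_integralD.
- exact: (lte_add_pinfty Zlty Xlty).
- exact: measurableT.
- by move=> w _; rewrite lee_fin powR_ge0.
- exact: (mpow (quantile01 Z \o U)).
- by move=> w _; rewrite lee_fin powR_ge0.
- exact: (mpow (quantile01 X \o U)).
Qed.

End uniform_variable.

(** * Comparison of shortfall moments and of Wasserstein distances *)

Lemma measurable_shortfall (s eta : R) Z :
  measurable_fun setT (fun w => (Num.max 0 (eta - Z w) `^ s)%:E).
Proof.
apply/measurable_EFinP; apply: (measurableT_comp (measurable_powR _)).
apply: measurable_maxr => //; exact: measurable_funB.
Qed.

Lemma Gamma_ge0 (r : R) : 0 <= Gamma r.
Proof.
by apply: Rintegral_ge0 => t _; rewrite mulr_ge0 ?powR_ge0 ?expR_ge0.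
Qed.

Lemma Fint_eq_law (r eta : R) X Y : r != 1 -> eq_law X Y ->
  Fint r X eta = Fint r Y eta.
Proof.
move=> /negbTE r1 XY; rewrite /Fint r1 expectation.unlock.
rewrite (@eq_law_ge0_integral _ _ _ _ _ _ _ X Y
  (fun x => (Num.max 0 (eta - x) `^ (r - 1))%:E) XY) => [//||].
  apply/measurable_EFinP; apply: (measurableT_comp (measurable_powR _)).
  apply: measurable_maxr => //; exact: measurable_funB.
by move=> x; rewrite lee_fin powR_ge0.
Qed.

Lemma le_Fint (r eta : R) X Y : 1 < r -> (forall w, Y w <= X w) ->
  (Fint r X eta <= Fint r Y eta)%E.
Proof.
move=> r1 YX; rewrite /Fint gt_eqF// expectation.unlock.
apply: lee_wpmul2l; first by rewrite lee_fin invr_ge0 Gamma_ge0.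
apply: ge0_le_integral => //.
- by move=> w _; rewrite lee_fin powR_ge0.
- exact: (measurable_shortfall _ _ X).
- exact: (measurable_shortfall _ _ Y).
- move=> w _; rewrite lee_fin; apply: ge0_ler_powR.
  + by rewrite subr_ge0 ltW.
  + by rewrite nnegrE le_max lexx.
  + by rewrite nnegrE le_max lexx.
  + by rewrite ge_max le_max lexx/= le_max lerD2l lerN2 YX orbT.
Qed.

(** The two quantiles agree on the domain of integration, and [quantile01] is measurable on the
    whole line. *)
Lemma wassersteinE l X Z :
  wasserstein l X Z =
  ((\int[lebesgue_measure]_(p in `]0%R, 1%R[)
     (`|quantile01 Z p - quantile01 X p| `^ l)%:E) `^ l^-1)%E.
Proof.
rewrite /wasserstein (eq_integral (fun p : measurableTypeR R =>
  (`|quantile01 Z p - quantile01 X p| `^ l)%:E)) => [//|p].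
by rewrite inE/= in_itv/= /quantile01 => ->.
Qed.

Lemma measurable_quantile_gap l X Z :
  measurable_fun setT (fun p => (`|quantile01 Z p - quantile01 X p| `^ l)%:E).
Proof.
apply/measurable_EFinP; apply: (measurableT_comp (measurable_powR _)).
by apply: measurableT_comp => //; exact: measurable_funB.
Qed.

Lemma le_wasserstein l X Z Z' : 0 < l ->
  (forall p, `|quantile01 Z' p - quantile01 X p| <=
             `|quantile01 Z p - quantile01 X p|) ->
  (wasserstein l X Z' <= wasserstein l X Z)%E.
Proof.
move=> l0 le; rewrite !wassersteinE.
apply: gt0_ler_poweR.
- by rewrite invr_ge0 ltW.
- by rewrite in_itv/= leey andbT integral_ge0// => p _; rewrite lee_fin powR_ge0.
- by rewrite in_itv/= leey andbT integral_ge0// => p _; rewrite lee_fin powR_ge0.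
apply: ge0_le_integral.
- exact: measurable_itv.
- by move=> p _; rewrite lee_fin powR_ge0.
- apply: measurable_funTS; exact: measurable_quantile_gap.
- apply: measurable_funTS; exact: measurable_quantile_gap.
- by move=> p _; rewrite lee_fin ge0_ler_powR// ltW.
Qed.

(** At [t = quantile Z p] one has [p <= cdf Z t <= cdf X t], and the Galois connection for [X]
    concludes. *)
Lemma dominates1_quantile01 Z X p : dominates 1 Z X ->
  quantile01 X p <= quantile01 Z p.
Proof.
move=> ZX; rewrite /quantile01; case: ifP => // p01.
rewrite quantile_le//; have := ZX (quantile Z p); rewrite /Fint eqxx.
by apply: le_trans; rewrite -quantile_le.
Qed.

(** Under the uniform law the quantile functions are integrable copies of [Z] and [X], so both
    expectations become integrals over the unit interval. *)
Lemma wasserstein1_dominates Z X :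
  (Z : T -> R) \in Lfun P 1 -> (X : T -> R) \in Lfun P 1 -> dominates 1 Z X ->
  wasserstein 1 Z X = ('E_P[Z] - 'E_P[X])%E.
Proof.
move=> LZ LX ZX; rewrite wassersteinE invr1 poweRe1; last first.
  by apply: integral_ge0 => p _; rewrite lee_fin powR_ge0.
rewrite -integral_uniform01; last 2 first.
- exact: measurable_quantile_gap.
- by move=> p; rewrite lee_fin powR_ge0.
have lawZ := eq_law_sym (quantile01_law Z).
have lawX := eq_law_sym (quantile01_law X).
rewrite (eq_law_expectation lawZ LZ) (eq_law_expectation lawX LX).
rewrite -expectationB; last 2 first.
- exact: (eq_law_Lfun ltr01 lawZ LZ).
- exact: (eq_law_Lfun ltr01 lawX LX).
rewrite unlock; apply: eq_integral => p _; congr EFin.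
(* [wasserstein] subtracts the quantile of its first argument, here [Z], hence the swap before the
   absolute value is dropped. *)
rewrite powRr1// distrC ger0_norm// subr_ge0.
exact: dominates1_quantile01.
Qed.

End quantile_coupling.

Theorem corollary1 (R : realType) (d : measure_display) (T : measurableType d)
    (P : probability T R) (hP : atomless P) (r l : R)
    (hr : 2 <= r) (hl1 : 1 <= l) (hlr : l <= r - 1)
    (X Y : {RV P >-> R}) (hX : Lrv (r - 1) X) (hY : Lrv (r - 1) Y) :
  ereal_inf [set wasserstein l X Z | Z in dominating_set r Y] =
  ereal_inf [set wasserstein l X Z | Z in
    [set Z : {RV P >-> R} |
      [/\ Lrv (r - 1) Z, dominates r Z Y & dominates 1 Z X]]] /\
  (l = 1 -> forall Z : {RV P >-> R},
    Lrv (r - 1) Z -> dominates r Z Y -> dominates 1 Z X ->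
    wasserstein 1 Z X = ('E_P[Z] - 'E_P[X])%E).
Proof.
have r1 : 1 <= r - 1 by exact: le_trans hlr.
have r_gt1 : 1 < r by rewrite (lt_le_trans _ hr)// ltrDl.
split; last first.
  move=> _ Z LZ _ ZX; apply: wasserstein1_dominates => //.
    by apply: (Lfun_subset _ _ _ _ LZ); rewrite ?lee_fin ?fin_num_measure.
  by apply: (Lfun_subset _ _ _ _ hX); rewrite ?lee_fin ?fin_num_measure.
apply/le_anti/andP; split.
  by apply: ereal_inf_le_tmp => _ [Z [LZ ZY _] <-]; exists Z.
apply: le_ereal_inf_tmp => _ [Z [LZ ZY] <-].
have [U Ut] := atomless_uniform hP.
pose Z' : {RV P >-> R} := quantile_max Z X \o U.
apply: ge_ereal_inf; exists (wasserstein l X Z').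
  exists Z'; last by []; split.
  - by apply: quantile_max_Lrv => //; exact: lt_le_trans r1.
  - move=> eta; apply: le_trans (ZY eta).
    (* [Z] is replaced by its copy [quantile01 Z \o U], which has the same law and lies pointwise
       below [Z']. *)
    rewrite -(Fint_eq_law eta _ (quantile01_uniform_law Z Ut)) ?gt_eqF//.
    by apply: le_Fint => // w; rewrite /Z' /= /quantile_max le_max lexx.
  - move=> eta; rewrite /Fint eqxx cdf_quantile_max//.
    by rewrite ge_min lexx orbT.
apply: le_wasserstein => [|p]; first exact: lt_le_trans hl1.
rewrite quantile01_quantile_max// /quantile_max.
(* Where the quantile of [X] is the larger one, the gap of [Z'] vanishes; elsewhere it equals that
   of [Z]. *)
by case: (leP (quantile01 Z p) (quantile01 X p)) => // _; rewrite subrr normr0.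
Qed.
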